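(* Let $K$ be a finitely generated torsion-free group, not isomorphic to $\{e\}$ or $\mathbb{Z}$, for which there exists $u>1$ such that every finitely generated subgroup $H$ of $K$ either satisfies $\omega(H)\geq u$ or is cyclic. Then for any automorphism of $K$, the corresponding semidirect product (non-proper HNN extension) $G=K\rtimes\mathbb{Z}$ has uniform exponential growth, and furthermore $\omega(G)\geq \min(u^{1/6},2^{1/16})$.
   Context: For a finitely generated group $G$ and a finite generating set $A$ of $G$, let $\gamma_A(n)$ be the number of elements of $G$ of word length at most $n$ with respect to $A\cup A^{-1}$, and let $\omega(G,A)=\lim_{n\to\infty}\gamma_A(n)^{1/n}$ (the limit exists since $\gamma_A$ is submultiplicative). The growth constant of $G$ is $\omega(G)=\inf_A \omega(G,A)$, the infimum being over all finite generating sets $A$ of $G$. $G$ has uniform exponential growth if $\omega(G)>1$. A non-proper HNN extension of $K$ is a semidirect product $K\rtimes_\alpha\mathbb{Z}=\langle K,t\mid tkt^{-1}=\alpha(k)\ (k\in K)\rangle$ for an automorphism $\alpha$ of $K$. Cyclic groups include the trivial group. *)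

(* Defs.v *)
From HB Require Import structures.
From mathcomp Require Import all_boot all_order all_algebra finmap.
From mathcomp Require Import all_classical all_reals all_analysis.
Set Implicit Arguments. Unset Strict Implicit. Unset Printing Implicit Defensive.
Import Order.TTheory GRing.Theory Num.Theory.
Import numFieldNormedType.Exports.
Local Open Scope classical_set_scope.
Local Open Scope ring_scope.

Section Subgroups.
Variable G : groupType.
Implicit Types H A : set G.

Definition is_subgroup H :=
  [/\ H 1%g, (forall x y, H x -> H y -> H (x * y)%g)
    & (forall x, H x -> H x^-1%g)].

Definition generated A : set G := smallest is_subgroup A.

Definition finitely_generated H :=
  exists A : {fset G}, generated [set` A] = H.

Definition cyclic_subgroup H := exists g : G, H = generated [set g].

Definition torsion_free :=
  forall (x : G) (n : nat), (0 < n)%N -> (x ^+ n = 1)%g -> x = 1%g.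

(* The elements of word length at most n with respect to A and inverses.     *)
Definition word_ball A (n : nat) : set G :=
  [set x | exists w : seq G,
     [/\ (size w <= n)%N,
         (forall y, y \in w -> A y \/ A y^-1%g)
       & x = (\prod_(y <- w) y)%g]].

Definition growth_fun A (n : nat) : nat := #|` fset_set (word_ball A n)|.

End Subgroups.

Section Growth.
Variables (R : realType) (G : groupType).

Definition growth_rate (A : {fset G}) : R :=
  limn (fun n : nat => (growth_fun [set` A] n)%:R `^ (n%:R^-1) : R).

(* The growth constant of a subgroup H of G.  As every generating set of H   *)
(* consists of elements of H, word lengths are computed inside H; the growth *)
(* constant of G itself is obtained with H := setT.                          *)
Definition growth_constant (H : set G) : R :=
  inf [set growth_rate A | A in [set A : {fset G} | generated [set` A] = H]].

(* If G is not finitely generated, the infimum is over the empty set and is  *)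
(* 0 by convention, so that the property below fails.                        *)
Definition uniform_exponential_growth := 1 < growth_constant [set: G].

End Growth.

Definition isomorphic (G H : groupType) :=
  exists f : {multiplicative G -> H}, bijective f.

Record automorphism (K : groupType) := Automorphism {
  aut_fun :> {multiplicative K -> K};
  aut_inv : K -> K;
  aut_funK : cancel aut_fun aut_inv;
  aut_invK : cancel aut_inv aut_fun
}.

(* The pair (k, m) stands for k * t ^ m.  The automorphism is a phantom       *)
(* parameter of the carrier: it only determines the group law defined below. *)
Record semidirectZ (K : groupType) (alpha : automorphism K) :=
  SemidirectZ { sd_base : K; sd_exp : int }.

Section SemidirectZ.
Variables (K : groupType) (alpha : automorphism K).
Local Notation semidirectZ := (semidirectZ alpha).
Local Notation SemidirectZ := (SemidirectZ alpha).

Definition aut_pow (m : int) (k : K) : K :=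
  match m with
  | Posz n => iter n alpha k
  | Negz n => iter n.+1 (aut_inv alpha) k
  end.

Definition sd_pair (x : semidirectZ) := (sd_base x, sd_exp x).
Definition pair_sd (p : K * int) := SemidirectZ p.1 p.2.

Lemma sd_pairK : cancel sd_pair pair_sd.
Proof. by case. Qed.

HB.instance Definition _ := Choice.copy semidirectZ (can_type sd_pairK).

Definition sd_one := SemidirectZ 1%g 0.

Definition sd_mul (x y : semidirectZ) :=
  SemidirectZ (sd_base x * aut_pow (sd_exp x) (sd_base y))%g
              (sd_exp x + sd_exp y).

Definition sd_inv (x : semidirectZ) :=
  SemidirectZ (aut_pow (- sd_exp x) (sd_base x)^-1%g) (- sd_exp x).

Lemma aut_powS m k : aut_pow (m + 1) k = alpha (aut_pow m k).
Proof.
case: m => n; first by rewrite -PoszD addn1.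
case: n => [|n]; first by rewrite /= aut_invK.
have -> : Negz n.+1 + 1 = Negz n by rewrite !NegzE -(addn1 n.+1) PoszD opprD subrK.
by rewrite /= aut_invK.
Qed.

Lemma aut_powP m k : aut_pow (m - 1) k = aut_inv alpha (aut_pow m k).
Proof. by rewrite -{2}(subrK 1 m) aut_powS aut_funK. Qed.

Lemma aut_powD m n k : aut_pow (m + n) k = aut_pow m (aut_pow n k).
Proof.
elim/int_rect: m => [|m IH|m IH]; first by rewrite add0r.
- by rewrite -(addn1 m) PoszD addrAC !aut_powS IH.
- by rewrite -(addn1 m) PoszD opprD addrAC !aut_powP IH.
Qed.

Lemma aut_pow_mul m : {morph aut_pow m : x y / (x * y)%g}.
Proof.
elim/int_rect: m => [//|m IH|m IH] x y.
- by rewrite -(addn1 m) PoszD !aut_powS IH gmulfM.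
- rewrite -(addn1 m) PoszD opprD !aut_powP IH.
  by apply: (can_inj (aut_funK alpha)); rewrite gmulfM !aut_invK.
Qed.

Lemma aut_pow1 m : aut_pow m 1%g = 1%g.
Proof. by apply: (@mulgI _ (aut_pow m 1%g)); rewrite -aut_pow_mul !mulg1. Qed.

Lemma sd_mulA : associative sd_mul.
Proof.
move=> [a m] [b n] [c p]; rewrite /sd_mul /=.
by rewrite addrA aut_pow_mul aut_powD mulgA.
Qed.

Lemma sd_mul1 : left_id sd_one sd_mul.
Proof. by move=> [a m]; rewrite /sd_mul /= mul1g add0r. Qed.

Lemma sd_mulr1 : right_id sd_one sd_mul.
Proof. by move=> [a m]; rewrite /sd_mul /= aut_pow1 mulg1 addr0. Qed.

Lemma sd_mulV : left_inverse sd_one sd_inv sd_mul.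
Proof.
by move=> [a m]; rewrite /sd_mul /= -aut_pow_mul mulVg aut_pow1 addNr.
Qed.

Lemma sd_mulrV : right_inverse sd_one sd_inv sd_mul.
Proof.
by move=> [a m]; rewrite /sd_mul /= -aut_powD subrr mulgV.
Qed.

HB.instance Definition _ :=
  isGroup.Build semidirectZ sd_mulA sd_mul1 sd_mulr1 sd_mulV sd_mulrV.

Definition sd_incl (k : K) : semidirectZ := SemidirectZ k 0.
Definition sd_t : semidirectZ := SemidirectZ 1%g 1.

Lemma sd_conj (k : K) :
  (sd_t * sd_incl k * sd_t^-1)%g = sd_incl (alpha k).
Proof.
apply: (canLR (mulgK _)).
change (sd_mul sd_t (sd_incl k) = sd_mul (sd_incl (alpha k)) sd_t).
by rewrite /sd_mul /= mul1g mulg1.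
Qed.

End SemidirectZ.

(* Main.v *)
(* Let g = [a, b] be a commutator of generators and c a generator.  If g and
   g ^ c generate a noncyclic subgroup of K, then K has u-exponential growth
   on elements of length at most 6.  Otherwise (g ^ c)^p = g^q with p and q
   coprime.  Either the positive words in c and cg are pairwise distinct, which
   gives growth at least 2^(1/5), or a coincidence between two of them shows
   that finitely many conjugates g ^ c^i generate a subgroup L normalized by c.
   A power g^(q^n) is then central in L; as (g ^ c)^(p q^m) = g^(q^(m+1)) and p,
   q are coprime, centrality descends from g^(q^(m+1)) to g^(q^m), hence to g.
   So L is abelian, hence cyclic, hence g ^ c = g or g^-1.  If this happens for
   all g and c, the commutators of generators generate a cyclic normal subgroup
   of G with abelian quotient, and K has polynomial growth: a contradiction. *)

Require Import Defs.
From HB Require Import structures.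
From mathcomp Require Import all_boot all_order all_algebra finmap.
From mathcomp Require Import all_classical all_reals all_analysis.
From mathcomp Require Import zify lra.
Set Implicit Arguments. Unset Strict Implicit. Unset Printing Implicit Defensive.
Import Order.TTheory GRing.Theory Num.Theory.
Import numFieldNormedType.Exports.
Local Open Scope classical_set_scope.
Local Open Scope ring_scope.

(** * Integer powers in a group *)

Section IntegerPowers.
Variable G : groupType.
Implicit Types (x y : G) (k m n : int).
Local Open Scope group_scope.

Definition expgz x k : G :=
  match k with Posz n => x ^+ n | Negz n => x ^- n.+1 end.

Lemma expgzS x k : expgz x (k + 1)%R = expgz x k * x.
Proof.
case: k => n; first by rewrite -PoszD addn1 /= expgSr.
case: n => [|n]; first by rewrite /= expg1 mulVg.
have -> : (Negz n.+1 + 1 = Negz n)%R by lia.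
by rewrite /= [x ^+ n.+2]expgS invgM mulgVK.
Qed.

Lemma expgz_pred x k : expgz x (k - 1)%R = expgz x k * x^-1.
Proof. by rewrite -{2}(subrK 1%R k) expgzS mulgK. Qed.

Lemma expgzD x m n : expgz x (m + n)%R = expgz x m * expgz x n.
Proof.
elim/int_rect: n => [|n IH|n IH]; first by rewrite addr0 mulg1.
- by rewrite -addn1 PoszD addrA !expgzS IH mulgA.
- by rewrite -addn1 PoszD opprD addrA !expgz_pred IH mulgA.
Qed.

Lemma expgzN x n : expgz x (- n)%R = (expgz x n)^-1.
Proof. by apply: (@mulgI _ (expgz x n)); rewrite -expgzD subrr mulgV. Qed.

Lemma expgz1 x : expgz x 1 = x. Proof. by []. Qed.

Lemma expgzA x m n : expgz x (m * n)%R = expgz (expgz x m) n.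
Proof.
elim/int_rect: n => [|n IH|n IH]; first by rewrite mulr0.
- by rewrite -addn1 PoszD expgzS -IH mulrDr mulr1 expgzD.
- by rewrite -addn1 PoszD opprD expgz_pred -IH mulrDr mulrN1 expgzD expgzN.
Qed.

Lemma expgz_conj x y k : expgz x k ^ y = expgz (x ^ y) k.
Proof. by case: k => n /=; rewrite ?conjVg conjXg. Qed.

(** Torsion-freeness is relative to a set [N], which will be the image of K in the semidirect
    product. *)
Lemma expgz_tf (N : set G) x k :
  (forall y (n : nat), N y -> (0 < n)%N -> y ^+ n = 1 -> y = 1) ->
  N x -> expgz x k = 1 -> x = 1 \/ k = 0%R.
Proof.
move=> tf Nx; case: k => [[|n]|n] /=; [by right|by move=> /tf; left; auto|].
by move=> /eqP; rewrite invg_eq1 => /eqP /tf; left; auto.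
Qed.

End IntegerPowers.

(** * Generated subgroups and conjugation *)

Section Subgroups.
Variable G : groupType.
Implicit Types (x y z g c : G) (A B H N : set G).
Local Open Scope group_scope.

Lemma generated_subgroup A : is_subgroup (generated A).
Proof.
split=> [H [[]]//|x y Ax Ay H [sH AH]|x Ax H [sH AH]]; case: (sH) => _ HM HV.
  by apply: HM; [apply: Ax|apply: Ay].
by apply: HV; apply: Ax.
Qed.

Lemma sub_generated A : A `<=` generated A.
Proof. exact: sub_smallest. Qed.

Lemma generated_min A H : is_subgroup H -> A `<=` H -> generated A `<=` H.
Proof. by move=> sH AH; apply: smallest_sub. Qed.

Lemma generated_sub A B : A `<=` generated B -> generated A `<=` generated B.
Proof. exact: (generated_min (generated_subgroup B)). Qed.

Lemma subgroup_preim_conj H c : is_subgroup H -> is_subgroup [set x | H (x ^ c)].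
Proof.
case=> H1 HM HV; split=> [|x y|x] /=; rewrite ?conj1g ?conjMg ?conjVg //.
  exact: HM.
exact: HV.
Qed.

Lemma subgroup_commute y : is_subgroup [set x | commute y x].
Proof. by split=> [|x x'|x] /=; [exact: commute1|exact: commuteM|exact: commuteV]. Qed.

Lemma subgroup_expgz H x k : is_subgroup H -> H x -> H (expgz x k).
Proof.
case=> H1 HM HV Hx; have HX n : H (x ^+ n).
  by elim: n => [//|n IH]; rewrite expgSr; exact: HM.
by case: k => n /=; [|apply: HV].
Qed.

Lemma commute_expgz x y k : commute x y -> commute x (expgz y k).
Proof. exact: (subgroup_expgz (H := [set z | commute x z]) k (subgroup_commute x)). Qed.

Lemma generated1P z x :
  generated [set z] x <-> exists k : int, x = expgz z k.
Proof.
split=> [|[k ->]]; last first.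
  by apply: subgroup_expgz (generated_subgroup _) _; exact: sub_generated.
apply: (@generated_min [set z] [set x | exists k : int, x = expgz z k]).
  split; first by exists 0%R.
  - by move=> _ _ [k ->] [l ->]; exists (k + l)%R; rewrite expgzD.
  - by move=> _ [k ->]; exists (- k)%R; rewrite expgzN.
by move=> _ ->; exists 1%R.
Qed.

(** If z^x = z^a and z^(x^-1) = z^b, then z^(ab) = z, so ab = 1 by torsion-freeness unless z is
    trivial. *)
Lemma conj_generator N z x :
  (forall y (n : nat), N y -> (0 < n)%N -> y ^+ n = 1 -> y = 1) -> N z ->
  generated [set z] (z ^ x) -> generated [set z] (z ^ x^-1) ->
  z ^ x = z \/ z ^ x = z^-1.
Proof.
move=> tf Nz /generated1P[a za] /generated1P[b zb].
have : expgz z (a * b - 1)%R = 1.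
  rewrite expgzD expgzN expgz1 mulrC expgzA -zb -expgz_conj -za -conjgM mulgV.
  by rewrite conjg1 mulgV.
move=> /(expgz_tf tf Nz)[->|ab]; first by left; rewrite conj1g.
have [a1|a1] : a = 1%R \/ a = (- 1)%R.
  have ab1 : (a * b = 1)%R by lia.
  have : (`|a| * `|b| = 1)%N by rewrite -abszM ab1.
  by move=> /eqP; rewrite muln_eq1 => /andP[/eqP]; lia.
- by left; rewrite za a1.
- by right; rewrite za a1.
Qed.

End Subgroups.

(** * Positive words in c and cg, and the conjugates of g by powers of c *)

Section Milnor.
Variables (G : groupType) (g c : G).
Local Open Scope group_scope.

Definition conjs (x : G) n : set G := (fun i => x ^ (c ^+ i)) @` `I_n.

(** The head of the list gives the last factor, so equal heads cancel on the right and equal last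
    entries on the left. *)
Fixpoint conj_word (e : seq bool) : G :=
  if e is b :: e' then conj_word e' * (c * g ^+ b) else 1.

Lemma conjs_finite x n : finite_set (conjs x n).
Proof. exact/finite_image/finite_II. Qed.

Lemma conjs_sub x m n : (m <= n)%N -> conjs x m `<=` conjs x n.
Proof. by move=> mn _ [i /= im <-]; exists i => //=; apply: leq_trans mn. Qed.

Lemma generated_conjsJ x n k y :
  generated (conjs x n) y -> generated (conjs x (n + k)) (y ^ (c ^+ k)).
Proof.
apply: (generated_min (subgroup_preim_conj (c ^+ k) (generated_subgroup _))).
move=> _ [i /= lt_in <-]; apply: sub_generated.
by exists (i + k)%N; rewrite /= ?ltn_add2r // expgnDr conjgM.
Qed.

Lemma generated_conjs_conj n y :
  generated (conjs g n) y -> generated (conjs (g ^ c) n) (y ^ c).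
Proof.
apply: (generated_min (subgroup_preim_conj c (generated_subgroup _))).
move=> _ [i /= lt_in <-]; apply: sub_generated.
by exists i => //; rewrite -!conjgM -expgS -expgSr.
Qed.

(** Moving every c to the left conjugates what it crosses: (c^n x)(c g^b) = c^(n+1) x^c g^b. *)
Lemma conj_wordE e :
  exists2 x, generated (conjs g (size e)) x & conj_word e = c ^+ size e * x.
Proof.
elim: e => [|b e [x gx IH]] /=.
  by exists 1; rewrite ?mulg1 //; case: (generated_subgroup (conjs g 0)).
have [H1 HM HV] := generated_subgroup (conjs g (size e).+1).
exists (x ^ c * g ^+ b); last first.
  by rewrite IH expgSr /conjg !mulgA mulgK.
apply: HM; first by have := generated_conjsJ (k := 1) gx; rewrite addn1.
case: b => //=; apply: sub_generated; exists 0%N => //=.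
by rewrite conjg1.
Qed.

Lemma conj_word_rcons e b : conj_word (rcons e b) = c * g ^+ b * conj_word e.
Proof. by elim: e => [|b' e IH] /=; rewrite ?mulg1 ?mul1g // IH !mulgA. Qed.

(** Once equal heads are cancelled, c^n x c g = c^n y c, that is, g = (x^-1 y)^c. *)
Lemma conj_word_coincide_head e f : size e = size f -> e <> f ->
  conj_word e = conj_word f -> exists n, generated (conjs (g ^ c) n) g.
Proof.
elim: e f => [|b e IH] [|b' f] //= [sz] ne.
case: (eqVneq b b') ne => [<-{b'} ne eq_ef|nb _].
  by apply: (IH f) => // [ef|]; [apply: ne; rewrite ef|exact: mulIg eq_ef].
wlog [-> ->] : b b' e f {IH} sz nb / b = true /\ b' = false.
  move=> wl eq_ef; case: b b' nb eq_ef => [] [] // _ eq_ef.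
    exact: (wl true false e f sz).
  exact: (wl true false f e (esym sz) erefl (conj erefl erefl) (esym eq_ef)).
have [x gx ->] := conj_wordE e; have [y gy ->] := conj_wordE f.
rewrite expg1 mulg1 -sz => eq_ef; exists (size e).
have eg : g = (x^-1 * y) ^ c.
  apply: (@mulgI _ (c ^+ size e * x * c)); rewrite -mulgA eq_ef.
  by rewrite /conjg !mulgA !mulgK.
have [_ HM HV] := generated_subgroup (conjs g (size e)).
rewrite [X in generated _ X]eg; apply: generated_conjs_conj.
by apply: HM; [exact: HV|rewrite sz].
Qed.

(** Once equal first factors are cancelled, c g c^n x = c c^n y, that is, g^(c^n) = y x^-1. *)
Lemma conj_word_coincide_last e f : size e = size f -> e <> f ->
  conj_word e = conj_word f -> exists n, generated (conjs g n) (g ^ (c ^+ n)).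
Proof.
elim/last_ind: e f => [|e b IH] f; first by case: f.
case/lastP: f => [|f b']; first by rewrite size_rcons.
rewrite !size_rcons !conj_word_rcons => -[sz] ne.
case: (eqVneq b b') ne => [<-{b'} ne eq_ef|nb _].
  by apply: (IH f) => // [ef|]; [apply: ne; rewrite ef|exact: mulgI eq_ef].
wlog [-> ->] : b b' e f {IH} sz nb / b = true /\ b' = false.
  move=> wl eq_ef; case: b b' nb eq_ef => [] [] // _ eq_ef.
    exact: (wl true false e f sz).
  exact: (wl true false f e (esym sz) erefl (conj erefl erefl) (esym eq_ef)).
have [x gx ->] := conj_wordE e; have [y gy ->] := conj_wordE f.
rewrite expg1 mulg1 -sz -!(mulgA c) => /mulgI eq_ef; exists (size e).
have -> : g ^ (c ^+ size e) = y * x^-1.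
  apply: (@mulgI _ (c ^+ size e)); apply: (@mulIg _ x).
  by rewrite -[RHS]mulgA mulgVK -eq_ef /conjg !mulgA mulgV mul1g.
have [_ HM HV] := generated_subgroup (conjs g (size e)).
by apply: HM; [rewrite sz|exact: HV].
Qed.

(* After cancelling common suffixes (resp. prefixes), a coincidence between two
   words expresses g by the conjugates g ^ c ^+ i with i > 0 (resp. some
   g ^ c ^+ n by those with i < n). *)
Lemma free_or_invariant :
  (forall n, injective (fun t : n.-tuple bool => conj_word t)) \/
  exists n, let L := generated (conjs g n) in
    [/\ L g, forall x, L x -> L (x ^ c) & forall x, L x -> L (x ^ c^-1)].
Proof.
have [inj|] := pselect (forall n, injective (fun t : n.-tuple bool => conj_word t)).
  by left.
move=> /existsNP[k] /existsNP[s] /existsNP[t] /not_implyP[eq_st ne_st]; right.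
have {}ne_st : (s : seq bool) <> t by move=> /val_inj.
have sz : size s = size t by rewrite !size_tuple.
have [m gm] := conj_word_coincide_head sz ne_st eq_st.
have [m' gm'] := conj_word_coincide_last sz ne_st eq_st.
(* Both memberships survive an increase of n: the first because the generating set grows, the second
   after conjugation by c^(n - m'). *)
exists (maxn m m') => /=; set n := maxn m m'.
have gn : generated (conjs (g ^ c) n) g.
  apply: generated_sub gm => y my; apply: sub_generated.
  by apply: conjs_sub my; exact: leq_maxl.
have gn' : generated (conjs g n) (g ^ (c ^+ n)).
  have := generated_conjsJ (k := n - m') gm'.
  by rewrite -conjgM -expgnDr subnKC ?leq_maxr.
have LJ x : generated (conjs g n) x -> generated (conjs g n) (x ^ c).
  apply: (generated_min (subgroup_preim_conj c (generated_subgroup _))).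
  move=> _ [i /= lt_in <-]; rewrite -conjgM -expgSr.
  have [<-|ne] := eqVneq n i.+1; first exact: gn'.
  apply: sub_generated; exists i.+1 => //=.
  by rewrite ltn_neqAle eq_sym ne.
have Lg : generated (conjs g n) g.
  apply: generated_sub gn => _ [i /= lt_in <-].
  rewrite -conjgM -expgS expgSr conjgM; apply: LJ.
  by apply: sub_generated; exists i.
split=> //; apply: (generated_min (subgroup_preim_conj c^-1 (generated_subgroup _))).
move=> _ [[|i] /= lt_in <-]; last first.
  rewrite expgSr conjgM conjgK; apply: sub_generated; exists i => //=.
  exact: ltnW.
(* The generator g has no predecessor among the generators, but it is a word in the g^(c^(i+1)) with
   i < n, which c^-1 lowers to generators. *)
rewrite conjg1; move: gn {lt_in}.
apply: (generated_min (subgroup_preim_conj c^-1 (generated_subgroup _))).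
move=> _ [i /= lt_in <-]; apply: sub_generated; exists i => //.
by rewrite -(conjgM g c) -expgS expgSr conjgM conjgK.
Qed.

Lemma invariant_abelian n (p q : int) :
  coprimez p q -> expgz (g ^ c) p = expgz g q ->
  (forall x, generated (conjs g n) x -> generated (conjs g n) (x ^ c)) ->
  (forall x, generated (conjs g n) x -> generated (conjs g n) (x ^ c^-1)) ->
  forall x y, generated (conjs g n) x -> generated (conjs g n) y -> commute x y.
Proof.
move=> /coprimezP [[a b] /= ab] gpq; set L := generated _ => LJ LV.
(* The centralizer of L in the whole group; it is stable under c and c^-1 because L is. *)
pose Z := [set x | forall y, L y -> commute x y].
have ZJ x : Z x -> Z (x ^ c).
  move=> Zx y Ly; rewrite -[y](conjgKV c) /commute -!conjMg.
  by rewrite Zx //; apply: LV.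
have ZV x : Z x -> Z (x ^ c^-1).
  move=> Zx y Ly; rewrite -[y](conjgK c) /commute -!conjMg.
  by rewrite Zx //; apply: LJ.
have sZ : is_subgroup Z.
  split=> [y _|x x' Zx Zx' y Ly|x Zx y Ly]; first by apply/commute_sym/commute1.
    by apply/commute_sym/commuteM; apply/commute_sym; [exact: Zx|exact: Zx'].
  by apply/commute_sym/commuteV/commute_sym; exact: Zx.
have gqn : Z (expgz g (q ^+ n)%R).
  move=> y; apply: (generated_min (subgroup_commute _)) => _ [i /= lt_in <-].
  (* Hence g^(q^n) is a power of every generator of L and commutes with it. *)
  have giq : expgz (g ^ (c ^+ i)) (p ^+ i)%R = expgz g (q ^+ i)%R.
    elim: i {lt_in} => [|i IH]; first by rewrite !expr0 conjg1.
    rewrite expgSr conjgM exprSr expgzA -expgz_conj IH expgz_conj -expgzA.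
    by rewrite mulrC expgzA gpq -expgzA exprS.
  have -> : (q ^+ n = q ^+ i * q ^+ (n - i))%R by rewrite -exprD subnKC // ltnW.
  rewrite expgzA -giq -expgzA.
  by rewrite /=; apply/commute_sym/commute_expgz.
have Zg : Z g.
  elim: {+}n gqn => [|m IH] gqm; first by rewrite expr0 in gqm.
  (* Bezout splits (g^c)^(q^m) into a power of (g^(q^(m+1)))^c and a power of (g^c)^(p q^m) =
     g^(q^(m+1)), both in [Z]; conjugation by c^-1 then gives g^(q^m). *)
  apply: IH; rewrite -[expgz _ _](conjgK c); apply: ZV; rewrite expgz_conj.
  have -> : (q ^+ m = q ^+ m.+1 * b + p * q ^+ m * a)%R.
    by rewrite exprS -[LHS]mulr1 -ab; lia.
  case: (sZ) => _ ZM _; rewrite expgzD; apply: ZM; rewrite expgzA.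
    by apply: subgroup_expgz sZ _; rewrite -expgz_conj; apply: ZJ.
  by rewrite expgzA gpq -(expgzA _ q) -exprS; apply: subgroup_expgz sZ _.
have LZ x : generated (conjs g n) x -> Z x.
  apply: (generated_min sZ) => _ [i _ <-].
  by elim: i => [|i IH]; rewrite ?conjg1 // expgSr conjgM; apply: ZJ.
by move=> x y /LZ Zx; apply: Zx.
Qed.
End Milnor.

(** * Word balls and their cardinality *)

Section WordBalls.
Variable G : groupType.
Implicit Types (A : set G) (x y : G).
Local Open Scope group_scope.

Lemma word_ball1 A n : word_ball A n 1.
Proof. by exists [::]; split=> //; rewrite big_nil. Qed.

Lemma word_ball_letter A x : A x -> word_ball A 1 x.
Proof.
move=> Ax; exists [:: x]; split=> // [y|]; last by rewrite big_seq1.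
by rewrite mem_seq1 => /eqP ->; left.
Qed.

Lemma word_ballM A m n x y :
  word_ball A m x -> word_ball A n y -> word_ball A (m + n) (x * y).
Proof.
move=> [w [sw Aw ->]] [v [sv Av ->]]; exists (w ++ v); split.
- by rewrite size_cat leq_add.
- by move=> z; rewrite mem_cat => /orP[/Aw|/Av].
- by rewrite big_cat.
Qed.

Lemma word_ballV A n x : word_ball A n x -> word_ball A n x^-1.
Proof.
move=> [w [sw Aw ->]]; exists [seq y^-1 | y <- rev w]; split.
- by rewrite size_map size_rev.
- move=> _ /mapP[y yw ->]; rewrite invgK; rewrite mem_rev in yw.
  by case: (Aw y yw); [right|left].
- elim: w {sw Aw} => [|y w IH]; first by rewrite !big_nil invg1.
  by rewrite rev_cons map_rcons -cats1 big_cat big_seq1 big_cons invgM IH.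
Qed.

Lemma word_ball_sub A m n : (m <= n)%N -> word_ball A m `<=` word_ball A n.
Proof. by move=> mn x [w [sw Aw ->]]; exists w; split=> //; apply: leq_trans mn. Qed.

Lemma word_ballR A x y : A x -> A y -> word_ball A 4 [~ x, y].
Proof.
move=> /word_ball_letter Ax /word_ball_letter Ay.
rewrite (_ : 4%N = (1 + (1 + (1 + 1)))%N) //.
by do 2 (apply: word_ballM; first exact: word_ballV); exact: word_ballM.
Qed.

Lemma word_ballJ A n x y : A y -> word_ball A n x -> word_ball A n.+2 (x ^ y).
Proof.
move=> /word_ball_letter Ay An; rewrite (_ : n.+2 = (1 + (n + 1))%N); last by lia.
by apply: word_ballM; [exact: word_ballV|exact: word_ballM].
Qed.

Lemma word_ball_subst (S A : set G) d n : S `<=` word_ball A d ->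
  word_ball S n `<=` word_ball A (d * n).
Proof.
move=> SA _ [w [sw Sw ->]]; apply: (@word_ball_sub _ (d * size w)).
  by rewrite leq_mul2l sw orbT.
elim: w Sw {sw} => [|y w IH] Sw; first by rewrite big_nil; exact: word_ball1.
rewrite big_cons mulnS; apply: word_ballM; last first.
  by apply: IH => z zw; apply: Sw; rewrite inE zw orbT.
have [|/SA/word_ballV] := Sw y (mem_head _ _); first exact: SA.
by rewrite invgK.
Qed.

Lemma word_ball_split A m n :
  word_ball A (m + n) = [set x * y | x in word_ball A m & y in word_ball A n].
Proof.
apply/seteqP; split=> [_ [w [sw Aw ->]]|_ [x Ax [y Ay <-]]]; last exact: word_ballM.
rewrite -(cat_take_drop m w) big_cat /=.
have Awt y : y \in take m w -> A y \/ A y^-1 by move=> /mem_take /Aw.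
have Awd y : y \in drop m w -> A y \/ A y^-1 by move=> /mem_drop /Aw.
exists (\prod_(y <- take m w) y).
  by exists (take m w); rewrite size_take_min geq_minl.
exists (\prod_(y <- drop m w) y) => //; exists (drop m w).
by split=> //; rewrite size_drop leq_subLR.
Qed.

(** [fset_set] is empty on infinite sets, so [growth_fun] counts the ball only thanks to this
    finiteness. *)
Lemma word_ball_finite A n : finite_set A -> finite_set (word_ball A n).
Proof.
move=> fA; elim: n => [|n IH].
  apply: (@sub_finite_set _ _ [set 1]); last exact: finite_set1.
  by move=> _ [w [+ _ ->]]; rewrite leqn0 size_eq0 => /eqP ->; rewrite big_nil.
rewrite -addn1 word_ball_split; apply: finite_image2 => //.
apply: (@sub_finite_set _ _ (1 |` (A `|` (fun x => x^-1) @` A))).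
  move=> _ [w [sw Aw ->]]; case: w sw Aw => [|y [|z w]] // _ Aw.
    by rewrite big_nil; left.
  rewrite big_seq1; right; case: (Aw y (mem_head _ _)) => [|Ay]; first by left.
  by right; exists y^-1 => //; rewrite invgK.
by rewrite finite_setU; split=> //; rewrite finite_setU; split=> //; exact: finite_image.
Qed.

Lemma growth_funM A m n : finite_set A ->
  (growth_fun A (m + n) <= growth_fun A m * growth_fun A n)%N.
Proof.
move=> fA; have fB k : finite_set (word_ball A k) by exact: word_ball_finite.
rewrite /growth_fun -(size_allpairs (fun x y => x * y)).
apply: uniq_leq_size; first exact: fset_uniq.
move=> z; rewrite in_fset_set // inE word_ball_split => -[x Ax [y Ay <-]].
by apply: allpairs_f; rewrite in_fset_set // inE.
Qed.

Lemma growth_fun_sub A B m n : finite_set B ->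
  word_ball A m `<=` word_ball B n -> (growth_fun A m <= growth_fun B n)%N.
Proof.
move=> fB AB; have fBn := word_ball_finite n fB.
by apply: fsubset_leq_card; rewrite -fset_set_sub //; exact: sub_finite_set fBn.
Qed.

Lemma growth_fun_gt0 A n : finite_set A -> (0 < growth_fun A n)%N.
Proof.
move=> fA; rewrite cardfs_gt0; apply/fset0Pn; exists 1.
by rewrite in_fset_set ?inE; [exact: word_ball1|exact: word_ball_finite].
Qed.

Lemma card_le_growth_fun (T : finType) (F : T -> G) A n : finite_set A ->
  injective F -> (forall t, word_ball A n (F t)) -> (#|T| <= growth_fun A n)%N.
Proof.
move=> fA injF FA; have fB := word_ball_finite n fA.
have <- : #|` [fset F t | t in T]%fset| = #|T|.
  by rewrite card_imfset //= -cardE; apply: eq_card => x; rewrite inE.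
apply/fsubset_leq_card/fsubsetP => _ /imfsetP[t _ ->].
by rewrite in_fset_set // inE.
Qed.

Lemma growth_fun_le_card (T : finType) (F : T -> G) A n :
  finite_set A -> word_ball A n `<=` range F -> (growth_fun A n <= #|T|)%N.
Proof.
move=> fA AF; have fB := word_ball_finite n fA.
apply: (@leq_trans #|` [fset F t | t in T]%fset|).
  apply/fsubset_leq_card/fsubsetP => x; rewrite in_fset_set // inE => /AF[t _ <-].
  by apply/imfsetP; exists t.
rewrite (leq_trans (leq_imfset_card _ _ _)) //= -cardE.
by rewrite max_card.
Qed.

End WordBalls.

(** Words over f(A) lift letter by letter, and injectivity preserves the count. *)
Lemma growth_fun_morph (K G : groupType) (f : UMagmaMorphism.type K G)
    (A : set K) n :
  injective f -> finite_set A -> growth_fun (f @` A) n = growth_fun A n.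
Proof.
move=> injf fA; rewrite /growth_fun.
have -> : word_ball (f @` A) n = f @` word_ball A n.
  apply/seteqP; split=> [_ [w [sw fAw ->]]|_ [_ [w [sw Aw ->]] <-]]; last first.
    exists (map f w); split; rewrite ?size_map ?big_map //; last first.
      exact: gmulf_prod.
    move=> _ /mapP[y /Aw Ay ->]; rewrite -gmulfV.
    by case: Ay => ?; [left; exists y|right; exists y^-1%g].
  move: sw; have [v vA ->] : exists2 v : seq K, (forall y, y \in v -> A y \/ A y^-1%g) &
      w = map f v.
    elim: w fAw => [|x w IH] fAw; first by exists [::].
    have [|v vA ->] := IH; first by move=> y yw; apply: fAw; rewrite inE yw orbT.
    have [y Ay ->] : exists2 y, A y \/ A y^-1%g & x = f y.
      have [[y Ay <-]|[y Ay fy]] := fAw x (mem_head _ _); first by exists y; [left|].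
      exists y^-1%g; first by right; rewrite invgK.
      by rewrite gmulfV fy invgK.
    exists (y :: v) => // z; rewrite inE => /predU1P[->//|]; exact: vA.
  rewrite size_map => sv; exists (\prod_(y <- v) y)%g; first by exists v.
  by rewrite big_map gmulf_prod.
rewrite fset_set_image ?card_imfset //; exact: word_ball_finite.
Qed.

(** * Polynomial growth when all commutators are powers of a single element h *)

Lemma leq_abszD (m n : int) : (`|(m + n)%R| <= `|m| + `|n|)%N.
Proof. lia. Qed.

Section Nilpotent.
Variables (G : groupType) (S : set G) (h : G).
Hypothesis S_finite : finite_set S.
Local Open Scope group_scope.
Local Notation H := (generated S).
Hypothesis h_conj : forall x, H x -> h ^ x = h \/ h ^ x = h^-1.
Hypothesis h_comm : forall x y, H x -> H y -> generated [set h] [~ x, y].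

Let wprod (w : seq G) := \prod_(y <- w) y.

Let H_wprod w : (forall x, x \in w -> H x) -> H (wprod w).
Proof.
have [H1 HM _] := generated_subgroup S.
elim: w => [|x w IH] Hw; first by rewrite /wprod big_nil.
rewrite /wprod big_cons; apply: HM; first exact: Hw (mem_head _ _).
by apply: IH => y yw; apply: Hw; rewrite inE yw orbT.
Qed.

(** Conjugation may flip the sign of the exponent, so only its absolute value is tracked. *)
Lemma expgz_passes x (k : int) : H x ->
  exists2 k' : int, `|k'|%N = `|k|%N & expgz h k * x = x * expgz h k'.
Proof.
move=> /h_conj hx; have := conjgC (expgz h k) x; rewrite expgz_conj => ->.
case: hx => ->; first by exists k.
by exists (- k)%R; rewrite ?abszN // expgzN; case: k => n /=; rewrite expVgn ?invgK.
Qed.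

Section Bounded.
Variables (L : seq G) (C : nat).
Hypothesis L_H : forall x, x \in L -> H x.
Hypothesis L_comm : forall x y, x \in L -> y \in L ->
  exists2 k : int, (`|k| <= C)%N & [~ x, y] = expgz h k.

(** Each letter x crossed by y leaves [x, y] = h^k, which travels to the right end changing at most
    its sign. *)
Lemma word_passes w y : {subset w <= L} -> y \in L ->
  exists2 j : int, (`|j| <= C * size w)%N &
    wprod w * y = y * wprod w * expgz h j.
Proof.
move=> wL yL; elim: w wL => [|x w IH] wL.
  by exists 0%R => //; rewrite /wprod big_nil !mulg1 mul1g.
have xL : x \in L by apply: wL; exact: mem_head.
have {}wL : {subset w <= L} by move=> z zw; apply: wL; rewrite inE zw orbT.
have [j ltj jE] := IH wL; have [k ltk kE] := L_comm xL yL.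
have [k' k'k k'E] := expgz_passes k (H_wprod (fun z zw => L_H (wL z zw))).
exists (k' + j)%R.
  by rewrite /= mulnS (leq_trans (leq_abszD _ _)) // leq_add ?k'k.
rewrite /wprod !big_cons -!/(wprod w) -mulgA jE !mulgA (commgC x y) kE.
by rewrite -!mulgA (mulgA (expgz h k)) k'E expgzD !mulgA.
Qed.

(* Sorting a word costs one commutator of letters, that is boundedly many
   powers of h, for each transposition. *)
Lemma word_perm w v : {subset w <= L} -> perm_eq w v ->
  exists2 j : int, (`|j| <= C * size w ^ 2)%N & wprod w = wprod v * expgz h j.
Proof.
elim: w v => [|y w IH] v wL wv.
  exists 0%R => //; have := perm_size wv.
  by move=> /esym/eqP; rewrite size_eq0 => /eqP ->; rewrite mulg1.
have yL : y \in L by apply: wL; exact: mem_head.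
have {}wL : {subset w <= L} by move=> z zw; apply: wL; rewrite inE zw orbT.
have yv : y \in v by rewrite -(perm_mem wv) mem_head.
(* Without y, [v] becomes [v1 ++ v2], a permutation of [w]; carrying y across [v1] costs at most C
   |w|, and C n + C n^2 <= C (n+1)^2. *)
case/splitPr: yv wv => v1 v2; rewrite perm_sym perm_catC /= perm_cons perm_sym.
rewrite perm_sym perm_catC perm_sym => wv.
have vL : {subset v1 ++ v2 <= L} by move=> z; rewrite -(perm_mem wv); exact: wL.
have v1L : {subset v1 <= L} by move=> z zv; apply: vL; rewrite mem_cat zv.
have v2L : {subset v2 <= L} by move=> z zv; apply: vL; rewrite mem_cat zv orbT.
have [j ltj jE] := IH _ wL wv; have [k ltk kE] := word_passes v1L yL.
have [k' k'k k'E] := expgz_passes (- k)%R (H_wprod (fun z zw => L_H (v2L z zw))).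
exists (k' + j)%R.
  have := perm_size wv; rewrite size_cat => sz.
  have : (C * size v1 <= C * size w)%N by rewrite leq_mul2l sz leq_addr orbT.
  move=> Cvw; rewrite abszN in k'k; rewrite (leq_trans (leq_abszD _ _)) // k'k.
  apply: leq_trans (leq_add (leq_trans ltk Cvw) ltj) _.
  by rewrite -mulnDr leq_mul2l /= -mulnn -mulnn; apply/orP; right; nia.
have -> : wprod (y :: w) = y * wprod w by rewrite /wprod big_cons.
have -> : wprod (v1 ++ y :: v2) = wprod v1 * y * wprod v2.
  by rewrite /wprod big_cat big_cons /= mulgA.
have -> : wprod w = wprod v1 * wprod v2 * expgz h j by rewrite jE /wprod big_cat.
have yv1 : y * wprod v1 = wprod v1 * y * expgz h (- k)%R by rewrite kE expgzN mulgK.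
by rewrite !mulgA yv1 -(mulgA _ (expgz h (- k)%R)) k'E expgzD !mulgA.
Qed.

End Bounded.

Lemma growth_fun_polynomial : exists D k, forall n,
  (growth_fun S n <= D * n.+1 ^ k)%N.
Proof.
pose A := S `|` (fun x => x^-1) @` S.
have fA : finite_set A by rewrite finite_setU; split=> //; exact: finite_image.
pose L : seq G := fset_set A.
have LA x : (x \in L) <-> S x \/ S x^-1.
  rewrite /L in_fset_set // inE /A; split=> [[Sx|[y Sy <-]]|[Sx|Sx]].
  - by left.
  - by right; rewrite invgK.
  - by left.
  - by right; exists x^-1 => //; exact: invgK.
have L_H x : x \in L -> H x.
  have [_ _ HV] := generated_subgroup S.
  move=> /LA[Sx|Sx]; first exact: sub_generated.
  by rewrite -[x]invgK; apply: HV; apply: sub_generated.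
have [C L_comm] : exists C : nat, forall x y, x \in L -> y \in L ->
    exists2 k : int, (`|k| <= C)%N & [~ x, y] = expgz h k.
  have /choice[kap kapE] : forall p : G * G, exists k : int,
      H p.1 -> H p.2 -> [~ p.1, p.2] = expgz h k.
    move=> [x y] /=; have [[Hx Hy]|nH] := pselect (H x /\ H y).
      by have /generated1P[k ->] := h_comm Hx Hy; exists k.
    by exists 0%R => Hx Hy; case: nH.
  exists (\max_(p <- allpairs pair L L) `|kap p|%N) => x y xL yL.
  exists (kap (x, y)); last exact: (kapE (x, y) (L_H _ xL) (L_H _ yL)).
  apply: (@leq_bigmax_seq _ _ xpredT (fun p => `|kap p|%N)) => //.
  exact: allpairs_f.
(* An element of the ball is determined by the letter counts of a word for it, each at most n, and
   by an exponent of h between -M and M; hence the degree |L| + 2. *)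
exists (2 * C).+1, (size L + 2)%N => n; pose M := (C * n ^ 2)%N.
pose P (f : {ffun 'I_(size L) -> 'I_n.+1}) : set (seq G) :=
  [set w | {subset w <= L} /\
    forall i : 'I_(size L), count_mem (nth 1 L i) w = f i].
(* A chosen word with letter counts f; the default [[::]] is never reached for counts coming from an
   actual word. *)
pose sel f := xget [::] (P f).
pose F (p : {ffun 'I_(size L) -> 'I_n.+1} * 'I_(2 * M).+1) : G :=
  wprod (sel p.1) * expgz h (p.2%:Z - M%:Z)%R.
have : word_ball S n `<=` range F.
  move=> _ [w [sw Sw ->]].
  have wL : {subset w <= L} by move=> x /Sw /LA.
  have cntw x : (count_mem x w < n.+1)%N by rewrite ltnS (leq_trans (count_size _ _)).
  pose f := [ffun i : 'I_(size L) => Ordinal (cntw (nth 1 L i))].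
  have [vL vE] : P f (sel f).
    by apply: xgetPex; exists w; split=> // i; rewrite ffunE.
  have wv : perm_eq w (sel f).
    apply/allP => x; rewrite mem_cat => /orP xwv /=.
    have xL : x \in L by case: xwv => [/wL|/vL].
    have ix : (index x L < size L)%N by rewrite index_mem.
    by have := vE (Ordinal ix); rewrite /f ffunE /= nth_index // => ->.
  have [j ltj wE] := word_perm L_H L_comm wL wv.
  rewrite -[\prod_(y <- w) y]/(wprod w) wE.
  have ltjM : (`|j| <= M)%N by rewrite (leq_trans ltj) // leq_mul2l leq_sqr sw orbT.
  have ltj' : (`|(j + M%:Z)%R| < (2 * M).+1)%N by lia.
  exists (f, Ordinal ltj') => //; rewrite /F /=; congr (_ * expgz h _).
  by lia.
move=> /(growth_fun_le_card S_finite) /leq_trans; apply.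
rewrite card_prod card_ffun !card_ord expnD mulnCA leq_mul2l; apply/orP; right.
by rewrite /M -[n.+1]addn1 sqrnD; nia.
Qed.

End Nilpotent.

(** * Exponential against polynomial growth, and growth rates as infima *)

Lemma powR_gt1 (R : realType) (a r : R) : 1 < a -> 0 < r -> 1 < a `^ r.
Proof.
move=> a1 r0; have one : 1 `^ r = 1 :> R by rewrite powR1.
rewrite -[ltLHS]one gt0_ltr_powR ?nnegrE //.
by rewrite ltW // (lt_trans ltr01).
Qed.

(** With v = u^(1/(k+1)), a Bernoulli inequality gives u^n >= y^(k+1) (n+1)^(k+1) for a fixed y > 0,
    one degree above the supposed bound. *)
Lemma exponential_not_polynomial (R : realType) (u : R) (D k : nat) : 1 < u ->
  ~ (forall n : nat, u ^+ n <= (D * n.+1 ^ k)%:R).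
Proof.
move=> u1 uD; have u0 : 0 < u by exact: lt_trans u1.
pose v := u `^ (k.+1%:R^-1).
have v1 : 1 < v.
  by rewrite powR_gt1 // invr_gt0 ltr0n.
have vu : v ^+ k.+1 = u.
  by rewrite -powR_mulrn ?powR_ge0 // -powRrM mulVf ?pnatr_eq0 // powRr1 // ltW.
(* The minimum with 1 secures the case n = 0 of the Bernoulli bound. *)
pose y := Num.min 1 (v - 1).
have y0 : 0 < y by rewrite lt_min ltr01 subr_gt0.
have vy n : y * n.+1%:R <= v ^+ n.
  elim: n => [|n IH]; first by rewrite mulr1 expr0 ge_min lexx.
  have -> : v ^+ n.+1 = v ^+ n + (v - 1) * v ^+ n.
    by rewrite mulrBl mul1r addrC subrK exprS.
  rewrite -(addn1 n.+1) natrD mulrDr mulr1 lerD //.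
  apply: (@le_trans _ _ (v - 1)); first by rewrite /y ge_min lexx orbT.
  by rewrite ler_peMr ?subr_ge0 ?exprn_ege1 // ?(ltW v1).
pose N := Num.bound (D%:R / y ^+ k.+1).
have := uD N; rewrite -vu exprAC leNgt => /negP; apply.
have DN : D%:R < y ^+ k.+1 * N.+1%:R.
  rewrite mulrC -ltr_pdivrMr ?exprn_gt0 //.
  rewrite (@lt_trans _ _ N%:R) ?ltr_nat // archi_boundP //.
  by rewrite divr_ge0 // exprn_ge0 // ltW.
have N0 : 0 < N.+1%:R ^+ k :> R by rewrite exprn_gt0 ?ltr0n.
rewrite natrM natrX (@lt_le_trans _ _ (y ^+ k.+1 * N.+1%:R * N.+1%:R ^+ k)) //.
  by rewrite ltr_pM2r.
rewrite -mulrA -exprS -exprMn lerXn2r ?nnegrE ?mulr_ge0 ?exprn_ge0 // ltW //.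
exact: lt_trans v1.
Qed.

Section GrowthRate.
Variable R : realType.

Lemma cvg_powR_harmonic (a : R) : 0 < a -> a `^ (n.+1%:R^-1) @[n --> \oo] --> (1 : R).
Proof.
move=> a0.
suff : a `^ (n.+1%:R^-1) @[n --> \oo] --> expR (0 * ln a) by rewrite mul0r expR0.
under eq_fun do rewrite /powR gt_eqF //.
apply: continuous_cvg; first exact: continuous_expR.
exact: (cvgM cvg_harmonic (cvg_cst _)).
Qed.

Section Fekete.
Variable a : nat -> nat.
Hypotheses (a_gt0 : forall n, (0 < a n)%N) (a_mono : {homo a : m n / (m <= n)%N}).
Hypothesis a_subM : forall m n, (a (m + n) <= a m * a n)%N.
Let r n : R := (a n)%:R `^ (n%:R^-1).

Lemma submultiplicative_mulnX m q : (a (m * q.+1) <= a m ^ q.+1)%N.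
Proof.
elim: q => [|q IH]; first by rewrite muln1.
by rewrite mulnS expnS (leq_trans (a_subM _ _)) // leq_mul2l IH orbT.
Qed.

(** Let q be the integer part of (n+1)/m. Monotonicity allows rounding n+1 up to m(q+1), so a(n+1)
    <= a(m)^(q+1), and (q+1)/(n+1) <= 1/m + 1/(n+1). *)
Let root_le m n : (0 < m)%N -> r n.+1 <= r m * (a m)%:R `^ (n.+1%:R^-1).
Proof.
move=> m0; have am1 : 1 <= (a m)%:R :> R by rewrite (ler_nat _ 1).
have am0 : (a m)%:R != 0 :> R by rewrite pnatr_eq0 -lt0n.
have le_n : (n.+1 <= m * (n.+1 %/ m).+1)%N by rewrite mulnC ltnW // ltn_ceil.
rewrite /r -powRD ?am0 ?implybT //.
apply: (@le_trans _ _ (((a m)%:R `^ (n.+1 %/ m).+1%:R) `^ n.+1%:R^-1)).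
  rewrite ge0_ler_powR ?invr_ge0 ?ler0n ?nnegrE ?powR_ge0 //.
  rewrite powR_mulrn ?ler0n // -natrX ler_nat.
  by rewrite (leq_trans (a_mono le_n)) // submultiplicative_mulnX.
rewrite -powRrM ler_powR // -addn1 natrD mulrDl mul1r lerD2r.
by rewrite ler_pdivrMr ?ltr0n // mulrC ler_pdivlMr ?ltr0n // -natrM ler_nat leq_trunc_div.
Qed.

Lemma fekete : cvgn r /\ forall m, (0 < m)%N -> limn r <= r m.
Proof.
(* Index 0 is excluded: as 0^-1 is 0, [r 0] is 1 whatever [a] is. *)
pose E := [set r m | m in [set m | (0 < m)%N]].
have rge0 n : 0 <= r n by exact: powR_ge0.
have Einf : has_inf E.
  split; first by exists (r 1%N), 1%N.
  by exists 0 => _ [m _ <-].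
have infE m : (0 < m)%N -> inf E <= r m.
  by move=> m0; apply: ge_inf; [case: Einf|exists m].
have rcvg : r n @[n --> \oo] --> inf E.
  rewrite -cvg_shiftS; apply/cvgrPdist_lt => e e0.
  have [_ [m /= m0 <-] rm] := inf_adherent e0 Einf.
  have : r m * (a m)%:R `^ (n.+1%:R^-1) @[n --> \oo] --> r m * 1.
    by apply: cvgM; [exact: cvg_cst|apply: cvg_powR_harmonic]; rewrite ltr0n.
  rewrite mulr1 => /cvgr_lt /(_ _ rm) [N _ HN]; exists N => // n /= Nn.
  rewrite distrC ger0_norm ?subr_ge0 ?infE // ltrBlDl.
  exact: le_lt_trans (root_le _ m0) (HN _ Nn).
split; first by apply/cvg_ex; exists (inf E).
by move=> m m0; rewrite (cvg_lim _ rcvg) // infE.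
Qed.

End Fekete.

Variable G : groupType.
Implicit Types (A : {fset G}) (H : set G).

Let growth_rate_fekete A :
  cvgn (fun n : nat => (growth_fun [set` A] n)%:R `^ (n%:R^-1) : R) /\
  forall m, (0 < m)%N ->
    growth_rate R A <= (growth_fun [set` A] m)%:R `^ (m%:R^-1).
Proof.
apply: fekete => [n|m n mn|m n].
- exact: growth_fun_gt0.
- by apply: growth_fun_sub => //; exact: word_ball_sub.
- exact: growth_funM.
Qed.

Lemma growth_rate_ge0 A : 0 <= growth_rate R A.
Proof.
by apply: limr_ge; [case: (growth_rate_fekete A)|apply: nearW => n; exact: powR_ge0].
Qed.

(** The limit is a lower bound of the roots, so a bound on the rate becomes a bound on every
    ball. *)
Lemma growth_rate_exp_le A n : growth_rate R A ^+ n <= (growth_fun [set` A] n)%:R.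
Proof.
case: n => [|n]; first by rewrite expr0 (ler_nat _ 1) growth_fun_gt0.
have [_ /(_ n.+1 isT) le_n] := growth_rate_fekete A.
rewrite (le_trans (lerXn2r _ _ _ le_n)) ?nnegrE ?growth_rate_ge0 ?powR_ge0 //.
by rewrite -powR_mulrn ?powR_ge0 // -powRrM mulVf ?pnatr_eq0 // powRr1 ?ler0n.
Qed.

(** Writing a for the growth function, y^n <= a(dn) <= a(n)^d by submultiplicativity, so the roots
    compare at every n >= 1. *)
Lemma growth_rate_ge (y : R) A (d : nat) : 0 <= y -> (0 < d)%N ->
  (forall n, y ^+ n <= (growth_fun [set` A] (d * n))%:R) ->
  y `^ (d%:R^-1) <= growth_rate R A.
Proof.
move=> y0 d0 yA; apply: limr_ge; first by case: (growth_rate_fekete A).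
exists 1%N => // n /= n0.
have nE : n%:R != 0 :> R by rewrite pnatr_eq0 -lt0n.
have dE : d%:R != 0 :> R by rewrite pnatr_eq0 -lt0n.
have -> : y `^ d%:R^-1 = (y ^+ n) `^ (d%:R^-1 * n%:R^-1).
  by rewrite -powR_mulrn // -powRrM mulrCA divff // mulr1.
have -> : (growth_fun [set` A] n)%:R `^ n%:R^-1 =
    ((growth_fun [set` A] n ^ d)%:R : R) `^ (d%:R^-1 * n%:R^-1).
  by rewrite natrX -powR_mulrn ?ler0n // -powRrM mulrA divff // mul1r.
rewrite ge0_ler_powR ?nnegrE ?mulr_ge0 ?invr_ge0 ?ler0n ?exprn_ge0 //.
rewrite (le_trans (yA n)) // ler_nat; case: d d0 {yA dE} => // d _.
by rewrite mulnC; apply: submultiplicative_mulnX => k l; exact: growth_funM.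
Qed.

Lemma growth_constant_le H A : generated [set` A] = H ->
  growth_constant R H <= growth_rate R A.
Proof.
move=> AH; apply: ge_inf; last by exists A.
by exists 0 => _ [B _ <-]; exact: growth_rate_ge0.
Qed.

(** Finite generation makes the set of rates nonempty; the infimum of the empty set would be 0. *)
Lemma growth_constant_ge H (y : R) : finitely_generated H ->
  (forall A, generated [set` A] = H -> y <= growth_rate R A) ->
  y <= growth_constant R H.
Proof.
move=> [A AH] yH; apply: lb_le_inf; first by exists (growth_rate R A), A.
by move=> _ [B BH <-]; exact: yH.
Qed.

End GrowthRate.

(** * Growth with respect to a generating set A of G, with N in the role of K *)

Section GeneratingSets.
Variables (R : realType) (u : R) (G : groupType) (N A : set G).
Hypotheses (u_gt1 : 1 < u) (A_finite : finite_set A) (A_gen : generated A = setT).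
Hypothesis N_subgroup : is_subgroup N.
Hypothesis N_comm : forall x y, N [~ x, y]%g.
Hypothesis N_tf : forall x (n : nat), N x -> (0 < n)%N -> (x ^+ n = 1)%g -> x = 1%g.
Hypothesis N_dichotomy : forall S, finite_set S -> S `<=` N ->
  (forall n, u ^+ n <= (growth_fun S n)%:R) \/ cyclic_subgroup (generated S).

Let normalN x y : N x -> N (x ^ y)%g.
Proof.
case: N_subgroup => _ NM _ Nx; rewrite -(mulVKg x (x ^ y)%g) -commgEl.
exact: NM.
Qed.

(** Polynomial growth rules out the exponential alternative. This serves with h = 1 for the abelian
    L, and later with a generator h of the commutators. *)
Lemma virtually_nilpotent_cyclic S h : finite_set S -> S `<=` N ->
  (forall x, generated S x -> h ^ x = h \/ h ^ x = h^-1)%g ->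
  (forall x y, generated S x -> generated S y -> generated [set h] [~ x, y]%g) ->
  cyclic_subgroup (generated S).
Proof.
move=> fS SN hJ hR; case: (N_dichotomy fS SN) => // uS.
have [D [k Dk]] := growth_fun_polynomial fS hJ hR.
case: (@exponential_not_polynomial R u D k u_gt1) => n.
by rewrite (le_trans (uS n)) // ler_nat.
Qed.

Lemma dichotomy_ball S d : finite_set S -> S `<=` N -> S `<=` word_ball A d ->
  ~ (forall n, u ^+ n <= (growth_fun A (d * n))%:R) ->
  exists2 z, N z & generated S = generated [set z].
Proof.
move=> fS SN SA nA; case: (N_dichotomy fS SN) => [uS|[z Sz]].
  case: nA => n; rewrite (le_trans (uS n)) // ler_nat.
  by apply: growth_fun_sub => //; exact: word_ball_subst.
exists z => //; apply: (generated_min N_subgroup SN).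
by rewrite Sz; exact: sub_generated.
Qed.

Lemma conj_sign g c : N g -> word_ball A 4 g -> A c ->
  ~ (forall n, u ^+ n <= (growth_fun A (6 * n))%:R) ->
  ~ (forall n, (2 ^ n <= growth_fun A (5 * n))%N) ->
  (g ^ c = g \/ g ^ c = g^-1)%g.
Proof.
move=> Ng g4 Ac nu n2.
have [free|[n [Lg LJ LV]]] := free_or_invariant g c.
  case: n2 => n; have -> : (2 ^ n)%N = #|{: n.-tuple bool}|.
    by rewrite card_tuple card_bool.
  apply: card_le_growth_fun (free n) _ => // t; rewrite -{1}(size_tuple t).
  elim: {t}(t : seq bool) => [|b e IH] /=; first exact: word_ball1.
  (* Each factor c g^b has length at most 1 + 4. *)
  rewrite (_ : 5 * (size e).+1 = 5 * size e + (1 + 4))%N; last by lia.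
  apply: word_ballM => //; apply: word_ballM; first exact: word_ball_letter.
  by case: b => //=; exact: word_ball1.
(* The constant 6 is the length bound 4 + 2 for g^c. *)
have [z Nz gz] : exists2 z, N z & generated [set g; g ^ c]%g = generated [set z].
  apply: dichotomy_ball nu => //.
  - by move=> _ [->|->] //; exact: normalN.
  - by move=> _ [->|->]; [apply: word_ball_sub g4|apply: word_ballJ].
have [P gP] : exists P : int, g = expgz z P.
  by apply/generated1P; rewrite -gz; apply: sub_generated; left.
have [Q gQ] : exists Q : int, (g ^ c)%g = expgz z Q.
  by apply/generated1P; rewrite -gz; apply: sub_generated; right.
have [p [q [pq gpq]]] : exists p q : int,
    coprimez p q /\ expgz (g ^ c)%g p = expgz g q.
  (* The exponents P and Q are divided by their gcd; if both vanish, g and g^c are trivial and p = q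
     = 1 works. *)
  have [d0|d0] := eqVneq (gcdz P Q) 0.
    have [P0 Q0] : P = 0 /\ Q = 0.
      by move/eqP: d0; rewrite gcdz_eq0 => /andP[/eqP-> /eqP->].
    by exists 1, 1; split=> //; rewrite gQ gP P0 Q0.
  have PE := divzK (dvdz_gcdl P Q); have QE := divzK (dvdz_gcdr P Q).
  move: PE QE; set p := (P %/ _)%Z; set q := (Q %/ _)%Z => PE QE.
  exists p, q; split; last first.
    rewrite gQ gP -!expgzA -[X in expgz z (X * p)]QE -[X in _ = expgz z (X * q)]PE.
    by rewrite mulrAC [q * p]mulrC mulrAC.
  have [a [b ab]] := Bezoutz P Q; apply/coprimezP; exists (a, b) => /=.
  by apply: (mulIf d0); rewrite mulrDl -!mulrA PE QE ab mul1r.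
have LN : conjs c g n `<=` N by move=> _ [i _ <-]; exact: normalN.
have Lab := invariant_abelian pq gpq LJ LV.
have [w Lw] : cyclic_subgroup (generated (conjs c g n)).
  apply: (@virtually_nilpotent_cyclic _ 1%g) => //; first exact: conjs_finite.
    by move=> x _; left; rewrite conj1g.
  move=> x y /Lab Lx /Lx /commgP/eqP ->.
  by case: (generated_subgroup [set 1%g : G]).
have Lw' : generated (conjs c g n) w by rewrite Lw; exact: sub_generated.
have Nw : N w by apply: (generated_min N_subgroup LN).
have [k ->] : exists k : int, g = expgz w k by apply/generated1P; rewrite -Lw.
rewrite !expgz_conj; have := @conj_generator _ N w c N_tf Nw.
rewrite -Lw => /(_ (LJ _ Lw') (LV _ Lw')) [->|->]; [by left|right].
by rewrite -[(w^-1)%g]/(expgz w (-1)) -expgzA mulN1r expgzN.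
Qed.

Lemma growth_lower_bound B : finite_set B -> B `<=` N ->
  ~ cyclic_subgroup (generated B) ->
  (forall n, u ^+ n <= (growth_fun A (6 * n))%:R) \/
  (forall n, (2 ^ n <= growth_fun A (5 * n))%N).
Proof.
move=> fB BN ncB.
have [|nu] := pselect (forall n, u ^+ n <= (growth_fun A (6 * n))%:R); first by left.
have [|n2] := pselect (forall n, (2 ^ n <= growth_fun A (5 * n))%N); first by right.
(* From here both growth bounds fail, and the subgroup generated by [B] has to be shown cyclic. *)
case: ncB; pose S := [set [~ x, y]%g | x in A & y in A].
have [z Nz Sz] : exists2 z, N z & generated S = generated [set z].
  apply: dichotomy_ball nu => //; first exact: finite_image2.
    by move=> _ [x _ [y _ <-]].
  by move=> _ [x Ax [y Ay <-]]; apply: (@word_ball_sub _ _ 4) => //; exact: word_ballR.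
set H := generated [set z]; have sH : is_subgroup H := generated_subgroup _.
have [H1 HM HV] := sH.
have SJ x y c : A x -> A y -> A c -> H ([~ x, y] ^ c)%g /\ H ([~ x, y] ^ c^-1)%g.
  move=> Ax Ay Ac; have Hxy : H [~ x, y]%g.
    by rewrite /H -Sz; apply: sub_generated; exists x => //; exists y.
  have [] := conj_sign (N_comm x y) (word_ballR Ax Ay) Ac nu n2.
    by move=> xyc; rewrite -{2}xyc conjgK xyc.
  move=> xyc; split; first by rewrite xyc; exact: HV.
  by rewrite -[[~ x, y]%g]invgK -xyc -conjVg conjgK; exact: HV.
(* Treating x and x^-1 together makes the set of such x closed under inverses, so it is enough to
   check generators. *)
have HJ x : forall y, H y -> H (y ^ x)%g /\ H (y ^ x^-1)%g.
  have : setT x by []; rewrite -A_gen.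
  apply: (@generated_min _ A [set x | forall y, H y -> H (y ^ x)%g /\ H (y ^ x^-1)%g]).
    split=> [y Hy|x1 x2 Hx1 Hx2 y Hy|x1 Hx1 y Hy].
    - by rewrite invg1 conjg1.
    - rewrite invgM !conjgM; split.
        by case: (Hx2 (y ^ x1)%g) => //; case: (Hx1 y).
      by case: (Hx1 (y ^ x2^-1)%g) => //; case: (Hx2 y).
    - by rewrite invgK; case: (Hx1 y).
  move=> c Ac y; rewrite /H -Sz => Sy; rewrite Sz -/H; split; move: Sy.
    apply: (generated_min (subgroup_preim_conj c sH)) => _ [x1 Ax1 [x2 Ax2 <-]].
    by case: (SJ x1 x2 c).
  apply: (generated_min (subgroup_preim_conj c^-1 sH)) => _ [x1 Ax1 [x2 Ax2 <-]].
  by case: (SJ x1 x2 c).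
(* Closure under products rests on [x1 x2, y] = [x1, y]^x2 [x2, y] and the normality of H. *)
have sub_comm y : is_subgroup [set x | H [~ x, y]%g].
  split=> [|x1 x2 /= Hx1 Hx2|x /= Hx]; first by rewrite /= comm1g.
    have -> : [~ x1 * x2, y]%g = ([~ x1, y] ^ x2 * [~ x2, y])%g.
      by rewrite /commg /conjg invgM !mulgA mulgK mulgK.
    by apply: HM => //; case: (HJ x2 _ Hx1).
  have -> : [~ x^-1, y]%g = ([~ x, y]^-1 ^ x^-1)%g.
    by rewrite invgR /commg /conjg invgK !mulgA mulgK.
  by case: (HJ x _ (HV _ Hx)).
(* Generators are replaced by arbitrary elements in one entry, then in the other, the entries being
   swapped by inversion. *)
have HR x y : H [~ x, y]%g.
  have : setT x by []; rewrite -A_gen; apply: (generated_min (sub_comm y)) => a Aa /=.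
  rewrite -invgR; apply: HV.
  have : setT y by []; rewrite -A_gen; apply: (generated_min (sub_comm a)) => b Ab /=.
  by rewrite /H -Sz; apply: sub_generated; exists b => //; exists a.
(* H is normal and generated by z, so every conjugate of z is z or z^-1. *)
apply: (@virtually_nilpotent_cyclic B z) => // [x _|x y _ _]; last exact: HR.
by apply: (conj_generator N_tf Nz); case: (HJ x z) => //; exact: sub_generated.
Qed.

End GeneratingSets.

(** * Images of generated subgroups, and torsion-free cyclic groups *)

Lemma generated_image (K G : groupType) (f : UMagmaMorphism.type K G) (A : set K) :
  generated (f @` A) = f @` generated A.
Proof.
have [H1 HM HV] := generated_subgroup A.
apply/seteqP; split.
  apply: generated_min; last by move=> _ [x Ax <-]; exists x => //; exact: sub_generated.
  split; first by exists 1%g => //; exact: gmulf1.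
  - move=> _ _ [x Hx <-] [y Hy <-]; exists (x * y)%g; last exact: gmulfM.
    exact: HM.
  - by move=> _ [x Hx <-]; exists (x^-1)%g; [exact: HV|exact: gmulfV].
have [F1 FM FV] := generated_subgroup (f @` A).
move=> _ [x Ax <-]; move: x Ax.
apply: (@generated_min _ A [set x | generated (f @` A) (f x)]); last first.
  by move=> x Ax; apply: sub_generated; exists x.
split=> [|x y Fx Fy|x Fx] /=; rewrite ?gmulf1 ?gmulfM ?gmulfV //.
  exact: FM.
exact: FV.
Qed.

Lemma isomorphic_morph (G H : groupType) (f : G -> H) :
  {morph f : x y / x * y}%g -> bijective f -> isomorphic G H.
Proof.
move=> fM bf.
pose F : {multiplicative G -> H} := HB.pack f (isMultiplicative.Build G H f fM).
by exists F.
Qed.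

(** A generator k other than 1 has infinite order, so [expgz k] is injective and taking exponents is
    an isomorphism onto the integers. *)
Lemma not_cyclic (K : groupType) : torsion_free K ->
  ~ isomorphic K (Algebra.to_multiplicative 'I_1) ->
  ~ isomorphic K (Algebra.to_multiplicative int) ->
  ~ cyclic_subgroup [set: K].
Proof.
move=> tf n1 nZ [k Kk].
have Kz x : exists n : int, x = expgz k n by apply/generated1P; rewrite -Kk.
have [k1|k1] := eqVneq k 1%g.
  have x1 (x : K) : x = 1%g.
    by have [[] n ->] := Kz x; rewrite k1 /= expg1n ?invg1.
  case: n1; apply: (@isomorphic_morph _ _ (fun=> ord0)) => [x y|].
    by rewrite [RHS]ord1.
  by exists (fun=> 1%g) => x; [rewrite [RHS]x1|rewrite [RHS]ord1].
have /choice[f fE] := Kz.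
have inj_k : injective (expgz k).
  move=> m n mn; have : expgz k (m - n) = 1%g by rewrite expgzD expgzN mn mulgV.
  move=> /(@expgz_tf K setT) []//; first by move=> y j _; exact: tf.
    by move/eqP: k1.
  by lia.
case: nZ; apply: (@isomorphic_morph K (Algebra.to_multiplicative int) f) => [x y|].
  by apply: inj_k; rewrite -fE [RHS]expgzD -!fE.
by exists (expgz k) => x; [rewrite -fE|apply: inj_k; rewrite -fE].
Qed.

(** * The embedding of K in the semidirect product *)

Section SemidirectProduct.
Variables (K : groupType) (alpha : automorphism K).
Local Notation incl := (sd_incl alpha).

Lemma sd_mulE (x y : semidirectZ alpha) : (x * y)%g = sd_mul x y.
Proof. by []. Qed.

Fact sd_incl_mul : {morph incl : x y / x * y}%g.
Proof. by move=> x y; rewrite sd_mulE /sd_mul /= addr0. Qed.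

HB.instance Definition _ :=
  isMultiplicative.Build K (semidirectZ alpha) incl sd_incl_mul.
HB.instance Definition _ :=
  Multiplicative_isUMagmaMorphism.Build K (semidirectZ alpha) incl erefl.

Lemma sd_incl_inj : injective incl.
Proof. by move=> x y []. Qed.

Lemma sd_exp0 (x : semidirectZ alpha) : sd_exp x = 0 -> range incl x.
Proof. by case: x => k m /= ->; exists k. Qed.

(** Exponents of t add under products, so they cancel in a commutator. *)
Lemma sd_commutator (x y : semidirectZ alpha) : range incl [~ x, y]%g.
Proof.
apply: sd_exp0; change (- sd_exp x + (- sd_exp y + (sd_exp x + sd_exp y)) = 0).
by lia.
Qed.

Lemma expgz_sd_t m : expgz (sd_t alpha) m = SemidirectZ alpha 1%g m.
Proof.
elim/int_rect: m => [//|m IH|m IH].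
- rewrite -addn1 PoszD expgzS IH.
  change (SemidirectZ alpha (1 * aut_pow alpha m 1)%g (m + 1) =
    SemidirectZ alpha 1%g (m + 1)).
  by rewrite aut_pow1 mulg1.
- rewrite -addn1 PoszD opprD expgz_pred IH.
  change (SemidirectZ alpha (1 * aut_pow alpha (- m%:Z) (aut_pow alpha (- 1) 1^-1))%g
    (- m%:Z + - 1) = SemidirectZ alpha 1%g (- m%:Z - 1)).
  by rewrite invg1 !aut_pow1 mulg1.
Qed.

Lemma sd_finitely_generated : finitely_generated [set: K] ->
  finitely_generated [set: semidirectZ alpha].
Proof.
move=> [A A_gen]; exists (sd_t alpha |` [fset incl x | x in A])%fset.
set S := [set` _]; apply/seteqP; split=> // -[k m] _.
have [_ SM _] := generated_subgroup S.
have -> : SemidirectZ alpha k m = (incl k * expgz (sd_t alpha) m)%g.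
  by rewrite expgz_sd_t sd_mulE /sd_mul /= mulg1 add0r.
apply: SM; last first.
  apply: subgroup_expgz (generated_subgroup S) _; apply: sub_generated.
  by rewrite /S /= fset1U1.
apply: (@generated_sub _ (incl @` [set` A])); last first.
  by rewrite generated_image A_gen; exists k.
move=> _ [x Ax <-]; apply: sub_generated; rewrite /S /= inE; apply/orP; right.
by apply/imfsetP; exists x.
Qed.

End SemidirectProduct.

(** * Growth constant of the semidirect product *)

Theorem theorem3p1 (R : realType) (K : groupType) (u : R)
  (K_fg : finitely_generated [set: K])
  (K_tf : torsion_free K)
  (K_ne1 : ~ isomorphic K (Algebra.to_multiplicative 'I_1))
  (K_neZ : ~ isomorphic K (Algebra.to_multiplicative int))
  (u_gt1 : 1 < u)
  (K_sub : forall H : set K, is_subgroup H -> finitely_generated H ->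
     u <= growth_constant R H \/ cyclic_subgroup H)
  (alpha : automorphism K) :
  uniform_exponential_growth R (semidirectZ alpha) /\
  Num.min (u `^ (1 / 6)) (2 `^ (1 / 16))
    <= growth_constant R [set: semidirectZ alpha].
Proof.
pose f : UMagmaMorphism.type K (semidirectZ alpha) := sd_incl alpha.
have injf : injective f := @sd_incl_inj K alpha.
suff ge_min : Num.min (u `^ (1 / 6)) (2 `^ (1 / 16))
    <= growth_constant R [set: semidirectZ alpha].
  split=> //; apply: lt_le_trans ge_min.
  by rewrite lt_min !powR_gt1 // ?ltr1n // divr_gt0.
(* S is pulled back to a finite subset of K. There u bounds the growth constant of the generated
   subgroup, hence the rate of this generating set, hence every ball. *)
have dichotomy S : finite_set S -> S `<=` range f ->
    (forall n, u ^+ n <= (growth_fun S n)%:R) \/ cyclic_subgroup (generated S).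
  move=> fS SN; pose A := fset_set (f @^-1` S).
  have AE : [set` A] = f @^-1` S.
    by rewrite fset_setK //; apply: finite_preimage => // x y _ _; exact: injf.
  have SE : S = f @` [set` A].
    rewrite AE; apply/seteqP; split=> [x Sx|_ [x Sx <-] //].
    by have [y _ yx] := SN x Sx; exists y => //=; rewrite yx.
  have [uA|[z Az]] :=
    K_sub (generated [set` A]) (generated_subgroup _) (ex_intro _ A erefl).
    left=> n; rewrite SE growth_fun_morph //; last exact: finite_fset.
    apply: le_trans (growth_rate_exp_le R A n).
    apply: lerXn2r; rewrite ?nnegrE ?growth_rate_ge0 ?(le_trans ler01 (ltW u_gt1)) //.
    exact: le_trans uA (growth_constant_le R erefl).
  by right; exists (f z); rewrite SE generated_image Az -generated_image image_set1.
have [B B_gen] := K_fg.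
apply: growth_constant_ge; first exact: sd_finitely_generated.
move=> A A_gen.
have [uA|A2] : (forall n, u ^+ n <= (growth_fun [set` A] (6 * n))%:R) \/
    (forall n, (2 ^ n <= growth_fun [set` A] (5 * n))%N).
  (* The noncyclic subgroup to be contradicted is the image of K itself, generated by the image of
     [B]. *)
  apply: (@growth_lower_bound R u _ (range f) [set` A] _ _ _ _ _ _ _
    (f @` [set` B])) => //.
  - split; first by exists 1%g.
      by move=> _ _ [x _ <-] [y _ <-]; exists (x * y)%g => //; rewrite gmulfM.
    by move=> _ [x _ <-]; exists (x^-1)%g => //; rewrite gmulfV.
  - exact: sd_commutator.
  - move=> _ n [x _ <-] n0 xn; suff -> : x = 1%g by exact: gmulf1.
    by apply: (K_tf x n n0); apply: injf; rewrite gmulfXn gmulf1.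
  - exact: finite_image.
  - by move=> _ [x _ <-]; exists x.
  - rewrite generated_image B_gen => -[z Kz].
    have [k _ kz] : range f z by rewrite Kz; exact: sub_generated.
    apply: (not_cyclic K_tf K_ne1 K_neZ); exists k; apply/seteqP; split=> // x _.
    have : range f (f x) by exists x.
    by rewrite Kz -kz -image_set1 generated_image => -[y ky /injf <-].
- by rewrite ge_min div1r (growth_rate_ge _ _ uA) // (le_trans ler01 (ltW u_gt1)).
(* The free case yields 2^(1/5), and 1/16 <= 1/5. *)
- apply: (@le_trans _ _ (2 `^ 5^-1)).
    by rewrite ge_min ler_powR ?orbT // ?ler1n //; lra.
  by apply: growth_rate_ge => // n; rewrite -natrX ler_nat.
Qed.
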